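(* Let $\varepsilon>0$ and let $\lambda_1,\lambda_2:[0,\infty)\to[0,\infty)$ be two BS density functions. For $j=1,2$ let $\mu_j(r)=\int_0^r\lambda_j(s)\,ds$ and $\mu_j^{-1}(q)=\sup\{r:\mu_j(r)\le q\}$. For a BS density function $\nu$, let $\left.\frac{C}{I}\right|_{\nu(r)}=\frac{R_1^{-\varepsilon}}{\sum_{i\ge2}R_i^{-\varepsilon}}$, where $R_1\le R_2\le\cdots$ are the ordered points of a Poisson point process on $[0,\infty)$ with intensity $\nu$. Suppose that for each $q>0$, with $a=\frac{\mu_2^{-1}(q)}{\mu_1^{-1}(q)}$, we have $$\frac1a\lambda_1\!\left(\frac ra\right)\ge\lambda_2(r)\quad\text{for all } r\ge\mu_2^{-1}(q).$$ Then $\left.\frac{C}{I}\right|_{\lambda_1(r)}\le_{\mathrm{st}}\left.\frac{C}{I}\right|_{\lambda_2(r)}$.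
   Context: A 1-D shotgun cellular system (SCS) with BS density function $\lambda(r)$ is a Poisson point process on $[0,\infty)$ with intensity $\lambda$ whose points are the distances of base stations from a mobile station at the origin; BSs have unit transmission power and unit shadow fading, path loss is $R^{-\varepsilon}$, and the mobile is served by the nearest BS. $\mu$ is the cumulative BS density function and $\mu^{-1}$ its (generalized) inverse as defined in the claim. For random variables $X,Y$, $X\le_{\mathrm{st}}Y$ means $\mathbb P(X>x)\le\mathbb P(Y>x)$ for all real $x$. *)

(* Defs.v *)
From HB Require Import structures.
From mathcomp Require Import all_boot all_order all_algebra.
From mathcomp Require Import all_classical all_reals all_analysis.
From mathcomp Require Import measurable_realfun.
Set Implicit Arguments. Unset Strict Implicit. Unset Printing Implicit Defensive.
Import Order.TTheory GRing.Theory Num.Theory.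
Import numFieldNormedType.Exports.
Local Open Scope classical_set_scope.
Local Open Scope ring_scope.

Section SCS.
Context {R : realType}.

(* Poisson probability mass function, rate^k/k! e^{-rate} (valid for rate = 0). *)
Definition pois_pmf (rate : R) (k : nat) : R :=
  rate ^+ k / k`!%:R * expR (- rate).

Definition BS_density (lam : R -> R) : Prop :=
  measurable_fun [set x : R | 0 <= x] lam /\
  (forall x, 0 <= x -> 0 <= lam x) /\
  (forall r, 0 <= r -> (lebesgue_measure : set R -> \bar R).-integrable `[0, r] (fun x => (lam x)%:E)).

Definition intensity (lam : R -> R) (A : set R) : \bar R :=
  (\int[lebesgue_measure]_(x in A) (lam x)%:E)%E.

Definition cum_density (lam : R -> R) (r : R) : R :=
  fine (intensity lam `[0, r]).

Definition cum_density_inv (lam : R -> R) (q : R) : \bar R :=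
  ereal_sup [set r%:E | r in [set r : R | 0 <= r /\ cum_density lam r <= q]].

(* number of indices i with point R_i(w) in A is exactly n (points counted with
   multiplicity; absent points are encoded by +oo) *)
Definition count_is {T : Type} (Rs : nat -> T -> \bar R) (w : T) (A : set R) (n : nat) : Prop :=
  exists s : seq nat, [/\ uniq s, size s = n &
    forall i, (exists x : R, Rs i w = x%:E /\ A x) <-> i \in s].

(* (Rs i) is the nondecreasingly ordered list of the points of a Poisson point
   process on [0,oo) with intensity lam (entries +oo when there are fewer points):
   for any finite family of pairwise disjoint bounded Borel subsets of [0,oo),
   the counts are independent Poisson with means \int_A lam. *)
Definition is_ordered_PPP {d : measure_display} {T : measurableType d}
    (P : probability T R) (lam : R -> R) (Rs : nat -> T -> \bar R) : Prop :=
  (forall i, measurable_fun [set: T] (Rs i : T -> \bar R)) /\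
  (forall i w, (0%:E <= Rs i w)%E /\ (Rs i w <= Rs i.+1 w)%E) /\
  (forall (k : nat) (A : nat -> set R) (n : nat -> nat),
     (forall j, (j < k)%N -> measurable (A j) /\
         exists b : R, A j `<=` `[0, b]) ->
     (forall j j', (j < k)%N -> (j' < k)%N -> j <> j' -> A j `&` A j' = set0) ->
     P [set w | forall j, (j < k)%N -> count_is Rs w (A j) (n j)] =
       (\prod_(j < k) pois_pmf (fine (intensity lam (A j))) (n j))%:E).

(* received power R^{-eps} of a BS at distance x (0 for an absent BS at +oo) *)
Definition path_gain (eps : R) (x : \bar R) : \bar R :=
  match x with
  | r%:E => if r == 0 then +oo%E else (r `^ (- eps))%:E
  | +oo%E => 0%E
  | -oo%E => +oo%E
  end.

(* C/I = R_1^{-eps} / sum_{i>=2} R_i^{-eps}   (indices shifted: R_1 is Rs 0) *)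
Definition CI (eps : R) {T : Type} (Rs : nat -> T -> \bar R) (w : T) : \bar R :=
  (path_gain eps (Rs 0%N w) * (\sum_(1 <= i <oo) path_gain eps (Rs i w))^-1)%E.

End SCS.

(* Main.v *)
(** Time change.  If [R_i] are the ordered points of a Poisson process with
    cumulative intensity [mu], the levels [V_i = mu (R_i)] form a unit rate
    Poisson process, whose law does not depend on [mu], and almost surely
    [R_i = mu^-1 (V_i)].  Feeding the same levels to [mu1^-1] and [mu2^-1]
    couples the two systems.  For [q = V_0] the hypothesis, integrated after the
    scaling [r = m2 s], says that [mu2 (m2 s) <= mu1 (m1 s)] for [s >= 1], where
    [m_j = mu_j^-1 (q)]; inverting, [mu1^-1 (v) / m1 <= mu2^-1 (v) / m2] for
    [v >= q].  Hence the ratios of the path gains to the gain of the nearest point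
    are pathwise larger in the first system, and [C/I] is pathwise smaller. *)

Require Import Defs.
From HB Require Import structures.
From mathcomp Require Import all_boot all_order all_algebra.
From mathcomp Require Import all_classical all_reals all_analysis.
From mathcomp Require Import measurable_realfun.
Import Order.TTheory GRing.Theory Num.Theory.
Local Open Scope classical_set_scope.
Local Open Scope ring_scope.

Import HBNNSimple.

(* [BS_density] speaks of [R] with its default display, Lebesgue integrals of
   [measurableTypeR R]: same sets, but the types of simple functions differ. *)
Lemma integral_measurableTypeR (R : realType) (mu : set R -> \bar R)
    (D : set R) (f : R -> \bar R) :
  @integral _ (measurableTypeR R) R mu D f = integral mu D f.
Proof.
rewrite /integral.
have E (g : R -> \bar R) :
    [set sintegral mu h | h in [set h : {nnsfun measurableTypeR R >-> R} |
       forall x, ((h x)%:E <= g x)%E]] =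
    [set sintegral mu h | h in [set h : {nnsfun R >-> R} |
       forall x, ((h x)%:E <= g x)%E]].
  apply/seteqP; split => _ [h hg <-].
  - have mh : measurable_fun [set: R] (h : R -> R).
      exact: (@measurable_funP _ _ (measurableTypeR R) R setT h).
    pose h' : {nnsfun R >-> R} := HB.pack (h : R -> R)
      (isMeasurableFun.Build _ _ R R h mh)
      (FiniteImage.Build _ _ h (@fimfunP _ _ h))
      (isNonNegFun.Build _ _ h (@fun_ge0 _ _ h)).
    by exists h'.
  - have mh : measurable_fun [set: measurableTypeR R] (h : R -> R).
      exact: (@measurable_funP _ _ R R setT h).
    pose h' : {nnsfun measurableTypeR R >-> R} := HB.pack (h : R -> R)
      (isMeasurableFun.Build _ _ (measurableTypeR R) R h mh)
      (FiniteImage.Build _ _ h (@fimfunP _ _ h))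
      (isNonNegFun.Build _ _ h (@fun_ge0 _ _ h)).
    by exists h'.
by rewrite !E.
Qed.

Lemma integrable_measurableTypeR (R : realType) (mu : set R -> \bar R)
    (D : set R) (f : R -> \bar R) :
  mu.-integrable D f -> @integrable _ (measurableTypeR R) R mu D f.
Proof.
by move=> /integrableP[mf intf]; apply/integrableP; rewrite integral_measurableTypeR.
Qed.

(** * Cumulative density: finiteness, monotonicity, continuity *)

Section Density.
Set Implicit Arguments.
Unset Strict Implicit.
Context {R : realType}.
Variable lam : R -> R.
Hypothesis lamP : BS_density lam.

Local Notation mu := (@lebesgue_measure R).
Local Notation cum := (cum_density lam).

Lemma integrable_density (r : R) : 0 <= r ->
  mu.-integrable `[0, r] (EFin \o lam).
Proof. by move=> r0; apply: integrable_measurableTypeR; exact: (lamP.2.2). Qed.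

Lemma measurable_density (A : set R) : measurable A -> A `<=` `[0, +oo[ ->
  measurable_fun A (EFin \o lam).
Proof.
move=> mA A0; apply/measurable_EFinP.
case: lamP => mlam _; apply: measurable_funS mlam => //.
  by rewrite (_ : [set x | _] = `[0, +oo[%classic)// set_itvE.
by move=> x /A0 /=; rewrite in_itv/= andbT.
Qed.

Lemma intensity_setU (A B : set R) : measurable A -> measurable B ->
  A `<=` `[0, +oo[ -> B `<=` `[0, +oo[ -> A `&` B = set0 ->
  intensity lam (A `|` B) = (intensity lam A + intensity lam B)%E.
Proof.
move=> mA mB A0 B0 AB; rewrite /intensity ge0_integral_setU//.
- apply: measurable_density; first exact: measurableU.
  by rewrite subUset.
- move=> x ABx; rewrite lee_fin; apply: (lamP.2.1).
  by case: ABx => [/A0|/B0] /=; rewrite in_itv/= andbT.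
- exact/disj_set2P.
Qed.

Lemma intensity_cum (r : R) : intensity lam `[0, r] = (cum r)%:E.
Proof.
rewrite /cum_density fineK//.
have [r0|r0] := leP 0 r; first by apply: integrable_fin_num => //; exact: integrable_density.
by rewrite set_itv_ge ?bnd_simp -?ltNge// /intensity integral_set0.
Qed.

Lemma intensity_ge0 (A : set R) : A `<=` `[0, +oo[ -> (0 <= intensity lam A)%E.
Proof.
move=> A0; apply: integral_ge0 => x /A0 /=; rewrite in_itv/= andbT => x0.
by rewrite lee_fin (lamP.2.1).
Qed.

Lemma intensity_setD (a b : R) : a <= b ->
  intensity lam (`[0, b] `\` `[0, a]) = (cum b - cum a)%:E.
Proof.
move=> ab; have abE : `[0, b]%classic = `[0, a] `|` (`[0, b] `\` `[0, a]).
  rewrite setDUK// => x /=; rewrite !in_itv/= => /andP[-> xa].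
  exact: le_trans xa ab.
rewrite EFinB -!intensity_cum [in RHS]abE intensity_setU//.
- by rewrite intensity_cum addeAC subee ?add0e.
- exact: measurableD.
- by move=> x /=; rewrite !in_itv/= andbT => /andP[].
- by move=> x [/=]; rewrite !in_itv/= andbT => /andP[].
- by rewrite setDIK.
Qed.

Lemma cum_density0 : cum 0 = 0.
Proof. by rewrite /cum_density set_itv1 /intensity integral_set1. Qed.

Lemma cum_density_le : {homo cum : x y / x <= y}.
Proof.
move=> a b ab; rewrite -subr_ge0 -lee_fin -intensity_setD//.
by apply: intensity_ge0 => x [/=]; rewrite !in_itv/= andbT => /andP[].
Qed.

Lemma cum_density_ge0 (r : R) : 0 <= cum r.
Proof.
have [/cum_density_le|r0] := leP 0 r; first by rewrite cum_density0.
by rewrite /cum_density set_itv_ge ?bnd_simp -?ltNge// /intensity integral_set0.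
Qed.

(** [cum] is continuous on [[0, b]] as a parameterized integral and vanishes at 0. It may have flat
    stretches, so [r] need not be unique. *)
Lemma cum_density_IVT (b c : R) : 0 <= b -> 0 <= c <= cum b ->
  exists2 r, 0 <= r <= b & cum r = c.
Proof.
move=> b0 cb.
have := @IVT _ cum 0 b c b0 (parameterized_integral_continuous b0 (integrable_density b0)).
rewrite cum_density0 min_l ?max_r ?cum_density_ge0// => /(_ cb)[r].
by rewrite in_itv/= => rb <-; exists r.
Qed.

End Density.

(* [cum_density_inv] extended to levels in [\bar R]. *)
Definition ecum_inv {R : realType} (lam : R -> R) (y : \bar R) : \bar R :=
  ereal_sup [set r%:E | r in [set r : R | 0 <= r /\ ((cum_density lam r)%:E <= y)%E]].

(** * Generalized inverse of the cumulative density *)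

Section GeneralizedInverse.
Set Implicit Arguments.
Unset Strict Implicit.
Context {R : realType}.
Variable lam : R -> R.
Hypothesis lamP : BS_density lam.
Hypothesis inv_fin : forall q : R, 0 < q -> cum_density_inv lam q \is a fin_num.

Local Notation cum := (cum_density lam).

Lemma ecum_invE (c : R) : ecum_inv lam c%:E = cum_density_inv lam c.
Proof. by []. Qed.

Lemma ecum_inv_le : {homo ecum_inv lam : x y / (x <= y)%E}.
Proof.
move=> x y xy; apply: le_ereal_sup => _ [r [r0 rx] <-]; exists r => //.
by split=> //; exact: le_trans rx xy.
Qed.

Lemma le_ecum_inv (r : R) (y : \bar R) :
  0 <= r -> ((cum r)%:E <= y)%E -> (r%:E <= ecum_inv lam y)%E.
Proof. by move=> r0 ry; apply: ereal_sup_ubound; exists r. Qed.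

Lemma ecum_inv_ge0 (y : \bar R) : (0 <= y)%E -> (0 <= ecum_inv lam y)%E.
Proof. by move=> y0; apply: le_ecum_inv; rewrite ?cum_density0. Qed.

Lemma ecum_invy : ecum_inv lam +oo%E = +oo%E.
Proof.
apply/eqyP => A A0; apply: le_ecum_inv; first exact: ltW.
exact: leey.
Qed.

(** By continuity the supremum [m] is attained with value exactly [c]; the last clause is the
    resulting Galois connection. Finiteness is inherited from the level [c + 1], which is positive
    even when [c = 0]. *)
Lemma ecum_inv_fin (c : R) : 0 <= c -> exists m : R,
  [/\ ecum_inv lam c%:E = m%:E, 0 <= m, cum m = c &
      forall r, 0 <= r -> (cum r <= c) = (r <= m)].
Proof.
move=> c0; have : ecum_inv lam c%:E \is a fin_num.
  have c1 := inv_fin (ltr_pwDr ltr01 c0).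
  rewrite ge0_fin_numE ?ecum_inv_ge0//; apply: le_lt_trans (_ : _ <= ecum_inv lam (c + 1)%:E)%E _.
    by apply: ecum_inv_le; rewrite lee_fin lerDl.
  by rewrite -ge0_fin_numE ?ecum_inv_ge0// lee_fin ltW// ltr_pwDr.
move=> /fin_numPlt/andP[]; case Em : (ecum_inv lam c%:E) => [m| |]// _ _.
have m0 : 0 <= m by rewrite -lee_fin -Em ecum_inv_ge0.
have le_m r : 0 <= r -> cum r <= c -> r <= m.
  by move=> r0 rc; rewrite -lee_fin -Em le_ecum_inv.
have cltm : c <= cum m.
  have [|r /andP[r0 _] rc] := @cum_density_IVT _ _ lamP (m + 1) c (addr_ge0 m0 ler01).
    rewrite c0 leNgt; apply/negP => /ltW /(le_m _ (addr_ge0 m0 ler01)).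
    by rewrite gerDl ler10.
  by rewrite -rc cum_density_le// le_m// rc.
have cm : cum m = c.
  apply/eqP; rewrite eq_le cltm andbT leNgt; apply/negP => ltcm.
  (* A strict excess leaves room for a value midway between [c] and [cum m], taken at some [r]; this
     [r] bounds the sublevel set, so [m <= r], against [cum r < cum m]. *)
  have [|r /andP[r0 rm] rc] := @cum_density_IVT _ _ lamP m ((c + cum m) / 2) m0.
    by rewrite !midf_le ?divr_ge0 ?addr_ge0 ?cum_density_ge0 //= ltW.
  have crm : cum r < cum m by rewrite rc midf_lt.
  have ccr : c < cum r by rewrite rc midf_lt.
  suff : m <= r by move=> /(cum_density_le lamP); rewrite leNgt crm.
  rewrite -lee_fin -Em; apply: ge_ereal_sup => _ [s [s0 sc] <-].
  rewrite lee_fin in sc *; rewrite leNgt; apply/negP => /ltW /(cum_density_le lamP).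
  by rewrite leNgt (le_lt_trans sc ccr).
exists m; split=> // r r0; apply/idP/idP; first exact: le_m.
by rewrite -cm; exact: cum_density_le.
Qed.

Lemma er_map_cum_le (x : \bar R) (c : R) : (0 <= x)%E -> 0 <= c ->
  (er_map cum x <= c%:E)%E = (x <= ecum_inv lam c%:E)%E.
Proof.
move=> x0 /ecum_inv_fin[m [-> _ _ cle]]; case: x x0 => [r| |]//=.
by rewrite !lee_fin => /cle.
Qed.

Lemma er_map_cum_le_mono : {homo er_map cum : x y / (x <= y)%E}.
Proof.
move=> [x| |] [y| |]//=; rewrite ?leey ?leNye//.
by rewrite !lee_fin; exact: cum_density_le.
Qed.

(** If the inverse overshoots [r], then [cum] is flat to the right of [r]. The endpoint is taken
    rational so that countably many flat stretches cover all such [r]. *)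
Lemma cum_density_flat (r : R) : 0 <= r -> ecum_inv lam (cum r)%:E != r%:E ->
  exists2 q : rat, r < ratr q & cum (ratr q) = cum r.
Proof.
move=> r0; have [m [-> m0 cm cle]] := ecum_inv_fin (cum_density_ge0 lamP r).
rewrite eqe => mr.
have ltrm : r < m by rewrite lt_neqAle eq_sym mr -cle ?lexx.
have [q] := rat_in_itvoo ltrm; rewrite in_itv/= => /andP[rq qm].
by exists q => //; apply/eqP; rewrite eq_le -{1}cm !cum_density_le// ltW.
Qed.

End GeneralizedInverse.

(** * Scaling comparison of the two cumulative densities *)

Section Ratio.
Set Implicit Arguments.
Unset Strict Implicit.
Context {R : realType}.

Local Notation mu := (@lebesgue_measure R).

(** Change of variables: the image of Lebesgue measure under division by [a], rescaled by [a^-1], is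
    Lebesgue measure, as lengths of half-open intervals show. *)
Lemma ge0_integral_lebesgue_scale (a : R) (D : set R) (f : R -> \bar R) :
  0 < a -> measurable D -> measurable_fun D f -> (forall x, D x -> 0 <= f x)%E ->
  (\int[mu]_(x in D) f x =
   (a^-1)%:E * \int[mu]_(x in (fun r => r / a)%R @^-1` D) f (x / a)%R)%E.
Proof.
move=> a0 mD mf f0; pose phi := fun r : measurableTypeR R => (r / a : measurableTypeR R).
have mphi : measurable_fun [set: measurableTypeR R] phi.
  exact: (@mulrr_measurable R setT a^-1).
have ai0 : 0 <= a^-1 by rewrite invr_ge0 ltW.
rewrite -(@ge0_integral_pushforward _ _ _ _ _ phi mphi mu D f)//; last first.
  by move=> y; rewrite inE; exact: f0.
rewrite -(@ge0_integral_mscale _ _ _ (pushforward mu phi) D mD (NngNum ai0))//.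
apply: eq_measure_integral => A mA _; apply: lebesgue_measure_unique => // _ [[x y] _ <-].
rewrite /= /mscale/= /pushforward.
have -> : phi @^-1` `]x, y] = `]x * a, y * a]%classic.
  by apply/seteqP; split => r /=; rewrite !in_itv/= /phi ltr_pdivlMr// ler_pdivrMr.
rewrite !lebesgue_measure_itv/= !lte_fin ltr_pM2r//; case: ifP => _; last by rewrite mule0.
by rewrite -!EFinB -EFinM -mulrBl mulrC mulfK ?gt_eqF.
Qed.

(** Both cumulative densities equal [q] at [m1] and [m2], so only the increments beyond matter; the
    substitution [r / a] brings both onto [D2], where the integrands compare pointwise. *)
Lemma cum_density_scale_le (lam1 lam2 : R -> R) (q m1 m2 s : R) :
  BS_density lam1 -> BS_density lam2 -> 0 < m1 -> 0 < m2 -> 1 <= s ->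
  cum_density lam1 m1 = q -> cum_density lam2 m2 = q ->
  (forall r, m2 <= r -> lam2 r <= (m2 / m1)^-1 * lam1 (r / (m2 / m1))) ->
  cum_density lam2 (m2 * s) <= cum_density lam1 (m1 * s).
Proof.
move=> L1 L2 m10 m20 s1 E1 E2 lam12.
set a := m2 / m1 in lam12; have a0 : 0 < a by rewrite divr_gt0.
have le_mul (m : R) : 0 < m -> m <= m * s by move=> m0; rewrite ler_peMr// ltW.
rewrite -(lerD2r (- q)) -{1}E2 -E1 -lee_fin -!intensity_setD ?le_mul// {q E1 E2}.
set D1 := `[0, m1 * s] `\` `[0, m1]; set D2 := `[0, m2 * s] `\` `[0, m2].
have D1_ge0 : D1 `<=` `[0, +oo[.
  by move=> x [/=]; rewrite !in_itv/= andbT => /andP[].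
have D2_ge0 : D2 `<=` `[0, +oo[.
  by move=> x [/=]; rewrite !in_itv/= andbT => /andP[].
have mD1 : measurable D1 by exact: measurableD.
have mD2 : measurable D2 by exact: measurableD.
have lam1_ge0 x : D1 x -> (0 <= (lam1 x)%:E)%E.
  by move=> /D1_ge0 /=; rewrite in_itv/= andbT lee_fin; exact: L1.2.1.
have lam2_ge0 x : D2 x -> (0 <= (lam2 x)%:E)%E.
  by move=> /D2_ge0 /=; rewrite in_itv/= andbT lee_fin; exact: L2.2.1.
rewrite /intensity (ge0_integral_lebesgue_scale a0 mD1 (measurable_density L1 mD1 D1_ge0))//.
have am : m1 * a = m2 by rewrite mulrC divfK ?gt_eqF.
have DE : (fun r => r / a) @^-1` D1 = D2.
  apply/seteqP; split => r; rewrite /D1 /D2 /= !in_itv/= !ler_pdivrMr//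
    pmulr_lge0 ?invr_gt0// mulrAC am //.
have lam1s_ge0 x : D2 x -> (0 <= (lam1 (x / a))%:E)%E by rewrite -DE => /lam1_ge0.
have mlam1s : measurable_fun D2 (fun x => (lam1 (x / a))%:E).
  rewrite -DE -[X in measurable_fun X](setTI _).
  apply: (@measurable_comp _ _ _ _ _ _ D1 (EFin \o lam1) _ (fun r : R => r / a)).
  - exact: mD1.
  - by move=> _ [r [_ ?] <-].
  - exact: measurable_density.
  - by rewrite setTI; apply: measurable_funTS; exact: mulrr_measurable.
rewrite DE -ge0_integralZl//; last by rewrite lee_fin invr_ge0 ltW.
apply: ge0_le_integral => //.
- exact: measurable_density.
- exact: measurable_funeM.
- move=> x [/=]; rewrite !in_itv/= => /andP[x0 _] /negP; rewrite x0/= -ltNge => /ltW xm.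
  by rewrite lee_fin; exact: lam12.
Qed.

Lemma ecum_inv_gt0 (lam : R -> R) (q m : R) : BS_density lam ->
  (forall p : R, 0 < p -> cum_density_inv lam p \is a fin_num) ->
  0 < q -> ecum_inv lam q%:E = m%:E -> 0 < m.
Proof.
move=> lamP inv_fin q0 Em.
have [m' [+ m0 cm _]] := ecum_inv_fin lamP inv_fin (ltW q0).
rewrite Em => -[->]; rewrite lt_neqAle m0 andbT; apply: contraTneq q0 => m'0.
by rewrite -cm -m'0 cum_density0 ltxx.
Qed.

(** For the dilation [s = M1 / m1], the first cumulative density at [m1 * s = M1] is [v]; the second
    one at [m2 * s] is then at most [v], and the Galois connection gives [m2 * s <= M2]. *)
Lemma ecum_inv_ratio_le (lam1 lam2 : R -> R) (q v m1 m2 M1 M2 : R) :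
  BS_density lam1 -> BS_density lam2 ->
  (forall p : R, 0 < p -> cum_density_inv lam1 p \is a fin_num) ->
  (forall p : R, 0 < p -> cum_density_inv lam2 p \is a fin_num) ->
  0 < q <= v ->
  ecum_inv lam1 q%:E = m1%:E -> ecum_inv lam2 q%:E = m2%:E ->
  ecum_inv lam1 v%:E = M1%:E -> ecum_inv lam2 v%:E = M2%:E ->
  (forall r, m2 <= r -> lam2 r <= (m2 / m1)^-1 * lam1 (r / (m2 / m1))) ->
  m2 / m1 * M1 <= M2.
Proof.
move=> L1 L2 F1 F2 /andP[q0 qv] Em1 Em2 EM1 EM2 lam12.
have v0 := lt_le_trans q0 qv.
have m10 := ecum_inv_gt0 L1 F1 q0 Em1; have m20 := ecum_inv_gt0 L2 F2 q0 Em2.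
have [x0 [+ _ cm1 _]] := ecum_inv_fin L1 F1 (ltW q0); rewrite Em1 => -[xE]; subst x0.
have [x1 [+ _ cm2 _]] := ecum_inv_fin L2 F2 (ltW q0); rewrite Em2 => -[xE]; subst x1.
have [x2 [+ M10 cM1 _]] := ecum_inv_fin L1 F1 (ltW v0); rewrite EM1 => -[xE]; subst x2.
have [x3 [+ _ _ cle]] := ecum_inv_fin L2 F2 (ltW v0); rewrite EM2 => -[xE]; subst x3.
have mM : m1 <= M1 by rewrite -lee_fin -Em1 -EM1 ecum_inv_le// lee_fin.
have s1 : 1 <= M1 / m1 by rewrite ler_pdivlMr// mul1r.
rewrite -mulrA [_^-1 * _]mulrC -cle ?mulr_ge0 ?invr_ge0 ?(ltW m10) ?(ltW m20)//.
have := cum_density_scale_le L1 L2 m10 m20 s1 cm1 cm2 lam12.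
by rewrite [m1 * _]mulrC divfK ?gt_eqF// cM1.
Qed.

End Ratio.

(** * Measurability of monotone functions on the extended reals *)

Section MonotoneMeasurability.
Set Implicit Arguments.
Unset Strict Implicit.
Context {R : realType}.

(** With [s] its supremum, such a set is one of the two rays ending at [s], according to whether it
    contains [s]. *)
Lemma measurable_downset (D : set (\bar R)) :
  (forall x y, (x <= y)%E -> D y -> D x) -> measurable D.
Proof.
move=> Ddown; set s := ereal_sup D.
have ltD x : (x < s)%E -> D x.
  by move=> /ereal_sup_gt[y Dy xy]; exact: Ddown (ltW xy) Dy.
have Dle x : D x -> (x <= s)%E by exact: ereal_sup_ubound.
have [Ds|nDs] := pselect (D s).
- have -> : D = `]-oo, s]%classic.
    apply/seteqP; split => x /=; rewrite in_itv/=; first exact: Dle.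
    by move=> xs; exact: Ddown xs Ds.
  exact: emeasurable_itv.
- have -> : D = `]-oo, s[%classic.
    apply/seteqP; split => x /=; rewrite in_itv/=; last exact: ltD.
    move=> Dx; rewrite lt_neqAle Dle// andbT.
    by apply: contra_notN nDs => /eqP <-.
  exact: emeasurable_itv.
Qed.

Lemma nonincreasing_emeasurable (f : \bar R -> \bar R) :
  {homo f : x y /~ (x <= y)%E} -> measurable_fun [set: \bar R] f.
Proof.
move=> fd; apply: (measurability _ (ErealGenOInfty.measurableE R)).
move=> _ [_ [r ->] <-]; rewrite setTI; apply: measurable_downset => x y xy /=.
by rewrite !in_itv/= !andbT => /lt_le_trans; apply; exact: fd.
Qed.

Lemma nondecreasing_emeasurable (f : \bar R -> \bar R) :
  {homo f : x y / (x <= y)%E} -> measurable_fun [set: \bar R] f.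
Proof.
move=> fi; apply: (measurability _ (ErealGenOInfty.measurableE R)).
move=> _ [_ [r ->] <-]; rewrite setTI -[X in measurable X]setCK.
apply: measurableC; apply: measurable_downset => x y xy /=.
by rewrite !in_itv/= !andbT; apply: contra_not => /lt_le_trans; apply; exact: fi.
Qed.

End MonotoneMeasurability.

(** * Path gains and the ratio C/I *)

Section CarrierToInterference.
Set Implicit Arguments.
Unset Strict Implicit.
Context {R : realType}.
Variable eps : R.
Hypothesis eps0 : 0 < eps.

Lemma path_gain_ge0 (x : \bar R) : (0 <= path_gain eps x)%E.
Proof. by case: x => [r| |]//=; case: ifP => // _; rewrite lee_fin powR_ge0. Qed.

Lemma path_gain_gt0 (r : R) : 0 < r -> path_gain eps r%:E = (r `^ (- eps))%:E.
Proof. by move=> r0; rewrite /= gt_eqF. Qed.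

Lemma path_gain_le (x y : \bar R) : (0 <= x)%E -> (x <= y)%E ->
  (path_gain eps y <= path_gain eps x)%E.
Proof.
move=> x0 xy; have y0 := le_trans x0 xy.
case: x y x0 y0 xy => [r| |] [s| |]//; rewrite ?lee_fin; last by rewrite path_gain_ge0.
rewrite le_eqVlt => /predU1P[<- _ _|r0 _ rs]; first by rewrite /= eqxx leey.
have s0 := lt_le_trans r0 rs.
rewrite !path_gain_gt0// lee_fin !powRN lef_pV2 ?posrE ?powR_gt0//.
by rewrite ge0_ler_powR ?nnegrE// ltW.
Qed.

Lemma measurable_path_gain d (T : measurableType d) (h : T -> \bar R) :
  measurable_fun [set: T] h -> (forall w, 0 <= h w)%E ->
  measurable_fun [set: T] (fun w => path_gain eps (h w)).
Proof.
(* Clamping by [maxe 0] leaves the values of [h] unchanged and makes the gain nonincreasing on all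
   of [\bar R]. *)
move=> mh h0; have -> : (fun w => path_gain eps (h w)) =
    (fun x : \bar R => path_gain eps (maxe 0%E x)) \o h.
  by apply/funext => w /=; rewrite max_r.
apply: measurableT_comp => //; apply: nonincreasing_emeasurable => x y xy.
apply: path_gain_le; first by rewrite le_max lexx.
by rewrite ge_max le_max lexx/= le_max xy orbT.
Qed.

Lemma measurable_CI d (T : measurableType d) (Rs : nat -> T -> \bar R) :
  (forall i, measurable_fun [set: T] (Rs i)) -> (forall i w, 0 <= Rs i w)%E ->
  measurable_fun [set: T] (CI eps Rs).
Proof.
move=> mRs Rs0.
have mS : measurable_fun [set: T]
    (fun w => \sum_(1 <= i <oo) path_gain eps (Rs i w))%E.
  rewrite (_ : (fun w => _) =
      fun w => (\sum_(i <oo) path_gain eps (Rs (i + 1)%N w))%E); last first.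
    apply/funext => w.
    by rewrite (@nneseries_addn _ (fun i => path_gain eps (Rs i w)) 1)// => i; exact: path_gain_ge0.
  apply: (ge0_emeasurable_sum (P := xpredT)) => [k w _ _|k _].
    exact: path_gain_ge0.
  exact: measurable_path_gain.
have -> : CI eps Rs = (fun w => path_gain eps (Rs 0%N w) *
    (maxe 0 (\sum_(1 <= i <oo) path_gain eps (Rs i w)))^-1)%E.
  apply/funext => w; rewrite /CI max_r// nneseries_ge0// => i _ _.
  exact: path_gain_ge0.
apply: emeasurable_funM; first exact: measurable_path_gain.
apply: (measurableT_comp (f := fun x : \bar R => (maxe 0 x)^-1%E)) mS.
apply: nonincreasing_emeasurable => x y xy.
rewrite lee_pV2; [|by rewrite inE le_max lexx..].
by rewrite ge_max le_max lexx/= le_max xy orbT.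
Qed.

(** With [k = p2 / p1], summation gives [S2 <= k * S1], hence
    [p1 / S1 = p2 / (k * S1) <= p2 / S2]. *)
Lemma ratio_le (g1 g2 : nat -> \bar R) (p1 p2 : R) : 0 < p1 -> 0 < p2 ->
  g1 0%N = p1%:E -> g2 0%N = p2%:E -> (forall i, 0 <= g1 i)%E ->
  (forall i, 0 <= g2 i)%E -> (forall i, g2 i <= (p2 / p1)%:E * g1 i)%E ->
  (g1 0%N * (\sum_(1 <= i <oo) g1 i)^-1 <= g2 0%N * (\sum_(1 <= i <oo) g2 i)^-1)%E.
Proof.
move=> p10 p20 -> -> g10 g20 g21.
set S1 := (\sum_(1 <= i <oo) g1 i)%E; set S2 := (\sum_(1 <= i <oo) g2 i)%E.
have S1_ge0 : (0 <= S1)%E by apply: nneseries_ge0.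
have S2_ge0 : (0 <= S2)%E by apply: nneseries_ge0.
have k0 : 0 < p2 / p1 by rewrite divr_gt0.
have S21 : (S2 <= (p2 / p1)%:E * S1)%E.
  by rewrite -nneseriesZl//; apply: lee_nneseries => // i *.
have : (p2%:E * ((p2 / p1)%:E * S1)^-1 <= p2%:E * S2^-1)%E.
  by rewrite lee_pmul2l ?lte_fin// lee_pV2// ?inE ?mule_ge0// lee_fin ltW.
(* What is left compares [p1 / S1] with [p2 / (k * S1)]: equal reals for finite nonzero [S1], both
   [+oo] when it is 0, both 0 when it is [+oo]. *)
apply: le_trans; clear -k0 p10 p20 S1_ge0; case: S1 S1_ge0 => [s| |]// s0.
  rewrite -EFinM !inver mulf_eq0 (gt_eqF k0)/=; case: ifP => s_eq0; last first.
    by rewrite -!EFinM lee_fin !invfM invrK mulrA mulrA divff ?gt_eqF// mul1r.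
  by rewrite !gt0_muley ?lte_fin.
by rewrite gt0_muley ?lte_fin// invey !mule0.
Qed.

End CarrierToInterference.

(** * Deterministic comparison for a common sequence of levels *)

Section PathwiseComparison.
Set Implicit Arguments.
Unset Strict Implicit.
Context {R : realType}.

(* [maxe 0] only serves to make the points nonnegative for every [v]. *)
Definition points_of_levels (lam : R -> R) (i : nat) (v : nat -> \bar R) : \bar R :=
  ecum_inv lam (maxe 0%E (v i)).

(** The coupling for one fixed sequence of levels: the hypothesis is used at the level [q] of the
    nearest point and bounds every gain relative to the nearest one. *)
Lemma CI_points_of_levels_le (eps : R) (lam1 lam2 : R -> R) (v : nat -> \bar R) :
  0 < eps -> BS_density lam1 -> BS_density lam2 ->
  (forall q : R, 0 < q ->
     exists m1 m2 : R,
       [/\ cum_density_inv lam1 q = m1%:E, cum_density_inv lam2 q = m2%:E &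
         let a := m2 / m1 in
         forall r : R, m2 <= r -> lam2 r <= a^-1 * lam1 (r / a)]) ->
  (0 < v 0%N)%E -> (forall i, v 0%N <= v i)%E ->
  (CI eps (points_of_levels lam1) v <= CI eps (points_of_levels lam2) v)%E.
Proof.
move=> eps0 L1 L2 lam12 v0 vi.
have F1 p : 0 < p -> cum_density_inv lam1 p \is a fin_num.
  by move=> /lam12[m1 [m2 [-> _ _]]].
have F2 p : 0 < p -> cum_density_inv lam2 p \is a fin_num.
  by move=> /lam12[m1 [m2 [_ -> _]]].
have vi0 i : (0 <= v i)%E by rewrite (le_trans (ltW v0)).
(* No base station at all: every point is at [+oo] in both systems, and the two ratios coincide. *)
have [vy|vny] := eqVneq (v 0%N) +oo%E.
  have viy i : v i = +oo%E by apply/eqP; rewrite eq_le leey -vy vi.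
  have pE i : points_of_levels lam1 i v = points_of_levels lam2 i v.
    by rewrite /points_of_levels viy max_r ?leey// !ecum_invy.
  rewrite le_eqVlt; apply/orP; left; apply/eqP; rewrite /CI pE; congr (_ * _^-1)%E.
  by apply: eq_eseriesr => i _; rewrite pE.
have [q Eq] : exists q, v 0%N = q%:E.
  by case: (v 0%N) v0 vny => [q| |]// _ _; exists q.
rewrite Eq in vi v0; rewrite lte_fin in v0.
have [m1 [m2 [Em1 Em2 lam12q]]] := lam12 q v0.
have m10 := ecum_inv_gt0 L1 F1 v0 Em1; have m20 := ecum_inv_gt0 L2 F2 v0 Em2.
have pg1 : path_gain eps (points_of_levels lam1 0 v) = (m1 `^ (- eps))%:E.
  by rewrite /points_of_levels max_r// Eq ecum_invE Em1 path_gain_gt0.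
have pg2 : path_gain eps (points_of_levels lam2 0 v) = (m2 `^ (- eps))%:E.
  by rewrite /points_of_levels max_r// Eq ecum_invE Em2 path_gain_gt0.
apply: (ratio_le (g1 := fun i => path_gain eps (points_of_levels lam1 i v))
  (g2 := fun i => path_gain eps (points_of_levels lam2 i v))
  _ _ pg1 pg2); rewrite ?powR_gt0//; [by move=> i; exact: path_gain_ge0..|].
move=> i; rewrite /points_of_levels max_r//; case Ev : (v i) (vi i) => [u| |]// qu; last first.
  by rewrite !ecum_invy mule0.
rewrite lee_fin in qu; have u0 := lt_le_trans v0 qu.
have [M1 [EM1 _ _ _]] := ecum_inv_fin L1 F1 (ltW u0).
have [M2 [EM2 _ _ _]] := ecum_inv_fin L2 F2 (ltW u0).
have M10 := ecum_inv_gt0 L1 F1 u0 EM1; have M20 := ecum_inv_gt0 L2 F2 u0 EM2.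
have qu0 : 0 < q <= u by rewrite v0.
have rM := ecum_inv_ratio_le L1 L2 F1 F2 qu0 Em1 Em2 EM1 EM2 lam12q.
rewrite EM1 EM2 !path_gain_gt0// -EFinM lee_fin.
have -> : m2 `^ (- eps) / m1 `^ (- eps) * M1 `^ (- eps) = (m2 / m1 * M1) `^ (- eps).
  rewrite [RHS]powRM ?divr_ge0 ?ltW//; congr (_ * _).
  apply: (canLR (mulfK _)); first by rewrite gt_eqF ?powR_gt0.
  by rewrite -powRM ?divr_ge0 ?divfK ?gt_eqF// ltW.
rewrite !powRN lef_pV2 ?posrE ?powR_gt0 ?mulr_gt0 ?invr_gt0//.
by rewrite ge0_ler_powR ?nnegrE ?mulr_ge0 ?invr_ge0// ltW.
Qed.

End PathwiseComparison.

(** * Counting ordered points in bounded sets *)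

Section Counting.
Set Implicit Arguments.
Unset Strict Implicit.
Context {R : realType} {T : Type}.
Variables (Rs : nat -> T -> \bar R) (w : T).

Lemma count_is_inj (A : set R) (n m : nat) :
  count_is Rs w A n -> count_is Rs w A m -> n = m.
Proof.
move=> [s [us <- sA]] [t [ut <- tA]]; apply/perm_size/uniq_perm => // i.
by apply/idP/idP => [/sA/tA|/tA/sA].
Qed.

Lemma count_is_setU (A B : set R) (n m : nat) : A `&` B = set0 ->
  count_is Rs w A n -> count_is Rs w B m -> count_is Rs w (A `|` B) (n + m).
Proof.
move=> AB [s [us <- sA]] [t [ut <- tB]]; exists (s ++ t); split.
- rewrite cat_uniq us ut andbT /=; apply/hasPn => i /tB[x [Rx Bx]].
  apply/negP => /sA[y [Ry Ay]]; suff : (A `&` B) x by rewrite AB.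
  by split=> //; move: Ry; rewrite Rx => -[->].
- by rewrite size_cat.
- move=> i; rewrite mem_cat; split.
    move=> [x [Rx [Ax|Bx]]]; apply/orP; first by left; apply/sA; exists x.
    by right; apply/tB; exists x.
  move=> /orP[/sA|/tB] [x [Rx Ax]]; exists x; split=> //; first by left.
  by right.
Qed.

Hypothesis Rs_ord : forall i, (0 <= Rs i w)%E /\ (Rs i w <= Rs i.+1 w)%E.

Lemma points_le (i j : nat) : (i <= j)%N -> (Rs i w <= Rs j w)%E.
Proof.
elim: j => [|j IH]; first by rewrite leqn0 => /eqP->.
rewrite leq_eqVlt => /predU1P[->|/IH ij]; first exact: lexx.
apply: le_trans ij _.
exact: (Rs_ord j).2.
Qed.

(** The points are ordered, so the indices of those in [[0, b]] form an initial segment of length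
    [n]. This translates counts into statements on single points. *)
Lemma count_is_itv (b : R) (n i : nat) :
  count_is Rs w `[0, b] n -> (Rs i w <= b%:E)%E = (i < n)%N.
Proof.
move=> [s [us <- sb]]; have {}sb j : (j \in s) = (Rs j w <= b%:E)%E.
  apply/idP/idP => [/sb[x [->]]|Rb].
    by rewrite /= in_itv/= lee_fin => /andP[].
  apply/sb; case: (Rs j w) Rb (Rs_ord j).1 => [x| |]//; rewrite !lee_fin => xb x0.
  by exists x; rewrite /= in_itv/= x0 xb.
(* Pigeonhole: if [i] is listed, so are [0, ..., i], and [s] has more than [i] entries; otherwise
   [s] only lists indices below [i]. *)
rewrite -sb; apply/idP/idP => [si|].
  rewrite -(size_iota 0 i.+1); apply: uniq_leq_size (iota_uniq _ _) _ => j.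
  rewrite mem_iota/= add0n ltnS sb => ji; apply: le_trans (points_le ji) _.
  by rewrite -sb.
apply: contraTT => nsi; rewrite -leqNgt -(size_iota 0 i).
apply: uniq_leq_size us _ => j sj; rewrite mem_iota/= add0n ltnNge.
apply: contra nsi => ij; by rewrite sb; apply: le_trans (points_le ij) _; rewrite -sb.
Qed.

Lemma count_is_ex (A : set R) (b : R) (n : nat) :
  A `<=` `[0, b] -> count_is Rs w `[0, b] n -> exists m, count_is Rs w A m.
Proof.
move=> Ab /count_is_itv nb.
pose s := [seq i <- iota 0 n | `[< exists x, Rs i w = x%:E /\ A x >]].
exists (size s), s; split=> //; first by rewrite filter_uniq ?iota_uniq.
move=> i; rewrite mem_filter mem_iota/= add0n -nb; split => [[x [Rx Ax]]|/andP[/asboolP]//].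
apply/andP; split; first by apply/asboolP; exists x.
by rewrite Rx lee_fin; have /Ab := Ax; rewrite /= in_itv/= => /andP[].
Qed.

Lemma count_is_seqD (b : nat -> R) (n : nat -> nat) (k : nat) :
  {homo b : i j / (i <= j)%N >-> i <= j} ->
  (forall j, (j < k)%N -> count_is Rs w (seqD (fun j => `[0, b j]%classic) j) (n j)) ->
  forall j, (j < k)%N -> count_is Rs w `[0, b j] (\sum_(l < j.+1) n l).
Proof.
move=> bhomo nk; elim=> [|j IH] jk; first by rewrite big_ord1; exact: nk 0%N jk.
rewrite big_ord_recr/=.
have -> : `[0, b j.+1]%classic = `[0, b j] `|` (`[0, b j.+1] `\` `[0, b j]).
  rewrite setDUK// => x /=; rewrite !in_itv/= => /andP[-> /le_trans]; apply.
  exact: bhomo.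
apply: count_is_setU; first by rewrite setDIK.
  by apply: IH; exact: ltnW.
exact: nk jk.
Qed.

End Counting.

(** Count vectors are coded by natural numbers so that a sum over vectors is an ordinary series.
    Numbers decoded by the default [[::]] are excluded from [codes_below] by the round trip through
    [pickle]. *)
Definition counts_of_code (m : nat) : seq nat := odflt [::] (unpickle m).

(* Codes of the counts [n_0, ..., n_{k-1}] in successive intervals for which the
   point of index [idx j] lies in the first [j.+1] intervals, for all [j < k]. *)
Definition codes_below (k : nat) (idx : nat -> nat) : set nat :=
  [set m | [/\ pickle (counts_of_code m) = m, size (counts_of_code m) = k &
    forall j, (j < k)%N -> (idx j < \sum_(l < j.+1) nth 0%N (counts_of_code m) l)%N]].

(** * Almost sure properties and joint law of the levels of a Poisson process *)

Section PoissonProcess.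
Set Implicit Arguments.
Unset Strict Implicit.
Context {R : realType} {d : measure_display} {T : measurableType d}.
Variable P : probability T R.
Variable lam : R -> R.
Variable Rs : nat -> T -> \bar R.
Hypothesis lamP : BS_density lam.
Hypothesis inv_fin : forall q : R, 0 < q -> cum_density_inv lam q \is a fin_num.
Hypothesis RsP : is_ordered_PPP P lam Rs.

Local Notation cum := (cum_density lam).

Lemma ae_of_probability1 (A : set T) : measurable A -> P A = 1%E ->
  {ae P, forall w, A w}.
Proof.
move=> mA PA; exists (~` A); split => //; first exact: measurableC.
by rewrite probability_setC// PA subee.
Qed.

Lemma le_probability_ae (A B : set T) : measurable A -> measurable B ->
  {ae P, forall w, A w -> B w} -> (P A <= P B)%E.
Proof.
move=> mA mB [N [mN PN ABN]].
have <- : P (B `|` N) = P B.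
  by rewrite measureU0.
apply: le_measure; rewrite ?inE//; first exact: measurableU.
move=> w Aw; have [Bw|nBw] := pselect (B w); first by left.
by right; apply: ABN => /= AB; exact/nBw/AB.
Qed.

Lemma sum_pois_pmf (rate : R) : 0 <= rate ->
  (\sum_(n <oo) (pois_pmf rate n)%:E = 1)%E.
Proof.
move=> rate0.
have -> : 1%E = ((expR (- rate))%:E * (expR rate)%:E)%E.
  by rewrite -EFinM expRN mulVf ?gt_eqF ?expR_gt0.
under eq_eseriesr do rewrite /pois_pmf EFinM muleC.
rewrite nneseriesZl/=; last by move=> n _; rewrite lee_fin divr_ge0// exprn_ge0.
congr (_ * _)%E; rewrite /expR -EFin_lim; last exact: is_cvg_series_exp_coeff.
by apply/congr_lim/funext => n /=; rewrite /series/= sumEFin.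
Qed.

(** The event is a countable union, over the possible index lists, of countable intersections of
    conditions on single points. *)
Lemma measurable_count_is (A : set R) (n : nat) : measurable A ->
  measurable [set w | count_is Rs w A n].
Proof.
move=> mA.
have -> : [set w | count_is Rs w A n] = \bigcup_(s : seq nat)
    (if uniq s && (size s == n) then
       \bigcap_i [set w | (exists x : R, Rs i w = x%:E /\ A x) <-> i \in s]
     else set0).
  apply/seteqP; split => w.
    move=> [s [us sn sA]]; exists s => //=; rewrite us sn eqxx/= => i _.
    exact: sA.
  move=> [s _]; case: ifP => // /andP[us /eqP sn] sA; exists s; split=> // i.
  exact: sA i I.
apply: countable_bigcupT_measurable => [|s]; first exact: countableP.
case: ifP => // _; apply: bigcapT_measurable => i.
have mi : measurable [set w | exists x : R, Rs i w = x%:E /\ A x].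
  rewrite (_ : [set w | _] = Rs i @^-1` (EFin @` A)); last first.
    apply/seteqP; split => w /=; first by move=> [x [-> Ax]]; exists x.
    by move=> [x Ax Rx]; exists x.
  rewrite -[X in measurable X]setTI; apply: (RsP.1 i measurableT).
  exact: measurable_image_EFin.
case is_s : (i \in s).
  by rewrite (_ : [set w | _ <-> _] = [set w | exists x : R, Rs i w = x%:E /\ A x])//;
    apply/seteqP; split => w /= => [[_ h]|h]; [exact: h|split].
rewrite (_ : [set w | _ <-> _] = ~` [set w | exists x : R, Rs i w = x%:E /\ A x]).
  exact: measurableC.
by apply/seteqP; split => w /=; [move=> [h _] /h|move=> h; split=> // /h].
Qed.

Lemma probability_count_is (A : set R) (b : R) (n : nat) : measurable A ->
  A `<=` `[0, b] ->
  P [set w | count_is Rs w A n] = (pois_pmf (fine (intensity lam A)) n)%:E.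
Proof.
move=> mA Ab.
have := RsP.2.2 1%N (fun=> A) (fun=> n) (fun _ _ => conj mA (ex_intro _ b Ab)).
rewrite big_ord1 => <-; last by case=> [|?] [|?].
congr (P _); apply/seteqP; split => w /=; first by move=> ? ? _.
by apply; exact: (isT : (0 < 1)%N).
Qed.

(** [count_is] does not by itself provide a count. The Poisson masses sum to 1, so almost surely
    some [n] occurs. *)
Lemma ae_finite_count (b : R) :
  {ae P, forall w, exists n, count_is Rs w `[0, b] n}.
Proof.
have mn n : measurable [set w | count_is Rs w `[0, b] n].
  exact: measurable_count_is.
suff : {ae P, forall w, (\bigcup_n [set w | count_is Rs w `[0, b] n]) w}.
  by apply: filterS => w [n _ wn]; exists n.
apply: ae_of_probability1; first exact: bigcupT_measurable.
rewrite measure_bigcup//; last first.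
  by move=> n m _ _ [w [/= wn wm]]; exact: count_is_inj wn wm.
rewrite -(sum_pois_pmf (cum_density_ge0 lamP b)) [LHS]eseries_mkcond; apply: eq_eseriesr => n _.
by rewrite in_setT; apply: (@probability_count_is _ b).
Qed.

Lemma ae_no_points (A : set R) (b : R) : measurable A -> A `<=` `[0, b] ->
  intensity lam A = 0%E ->
  {ae P, forall w, forall i x, Rs i w = x%:E -> ~ A x}.
Proof.
move=> mA Ab A0.
have : {ae P, forall w, count_is Rs w A 0}.
  apply: ae_of_probability1; first exact: measurable_count_is.
  by rewrite (probability_count_is _ mA Ab) A0 /pois_pmf/= expr0 fact0 oppr0 expR0 divr1 mulr1.
apply: filterS => w [s [_ /size0nil -> sA]] i x Rx Ax.
by have : i \in [::] by apply/sA; exists x.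
Qed.

(** The right side contains [c] and [idx] but not [lam], which is why both systems have the same law
    of levels. The event is split according to the counts in the rings between the radii of
    successive bounds. *)
Lemma probability_levels (k : nat) (idx : nat -> nat) (c : nat -> R) :
  {homo c : i j / (i <= j)%N >-> i <= j} -> 0 <= c 0%N ->
  P [set w | forall j, (j < k)%N -> (er_map cum (Rs (idx j) w) <= (c j)%:E)%E] =
  (\sum_(m <oo | m \in codes_below k idx)
    (\prod_(j < k) pois_pmf (c j - (if j : nat is j'.+1 then c j' else 0))
                            (nth 0%N (counts_of_code m) j))%:E)%E.
Proof.
move=> chomo c0.
have cge0 j : 0 <= c j by rewrite (le_trans c0)// chomo.
(* [b j] is the radius of level [c j]; the ring [A j] then has intensity [c j - c (j - 1)], with 0
   in place of the missing predecessor when [j = 0]. *)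
have /choice[b bP] : forall j, exists m : R,
  [/\ ecum_inv lam (c j)%:E = m%:E, 0 <= m, cum m = c j &
      forall r, 0 <= r -> (cum r <= c j) = (r <= m)].
  by move=> j; exact: ecum_inv_fin.
have bhomo : {homo b : i j / (i <= j)%N >-> i <= j}.
  move=> i j ij; have [bi _ _ _] := bP i; have [bj _ _ _] := bP j.
  by rewrite -lee_fin -bi -bj ecum_inv_le// lee_fin chomo.
pose A := seqD (fun j => `[0, b j]%classic).
have mA j : measurable (A j) by rewrite /A; case: j => [|j] //=; exact: measurableD.
have Ab j : A j `<=` `[0, b j] by rewrite /A; case: j => [|j] x //= [].
have intA j : fine (intensity lam (A j)) = c j - (if j is j'.+1 then c j' else 0).
  case: j => [|j]; first by rewrite /A/= intensity_cum//= subr0; have [] := bP 0%N.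
  rewrite /A/= intensity_setD//=; last exact: bhomo.
  by have [_ _ -> _] := bP j; have [_ _ -> _] := bP j.+1.
have tA : trivIset setT A.
  apply: trivIset_seqD => i j ij; apply/subsetPset => x /=.
  by rewrite !in_itv/= => /andP[-> /le_trans]; apply; exact: bhomo.
pose E := [set w | forall j, (j < k)%N -> (er_map cum (Rs (idx j) w) <= (c j)%:E)%E].
pose F m := [set w | forall j, (j < k)%N ->
  count_is Rs w (A j) (nth 0%N (counts_of_code m) j)].
have PF m : P (F m) =
    (\prod_(j < k) pois_pmf (c j - (if j : nat is j'.+1 then c j' else 0))
                            (nth 0%N (counts_of_code m) j))%:E.
  rewrite /F RsP.2.2; first by under eq_bigr do rewrite intA.
    by move=> j _; split; [exact: mA|exists (b j); exact: Ab].
  by move=> i j _ _ ij; apply/eqP/negPn/negP => /set0P Aij; apply: ij; exact: tA Aij.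
have mF m : measurable (F m).
  rewrite (_ : F m = \bigcap_(j in [set j | (j < k)%N])
      [set w | count_is Rs w (A j) (nth 0%N (counts_of_code m) j)]).
    by apply: bigcap_measurableType => j _; exact: measurable_count_is.
  by [].
have mE : measurable E.
  rewrite (_ : E = \bigcap_(j in [set j | (j < k)%N])
      (Rs (idx j) @^-1` [set x | (er_map cum x <= (c j)%:E)%E])).
    apply: bigcap_measurableType => j _.
    rewrite -[X in measurable X]setTI; apply: RsP.1 => //.
    by apply: measurable_downset => x y /(er_map_cum_le_mono lamP); exact: le_trans.
  by [].
(* Different canonical codes decode to different vectors, and the count in each ring is unique. *)
have tF : trivIset (codes_below k idx) F.
  move=> m m' [mK sm _] [m'K sm' _] [w [Fm Fm']].
  rewrite -mK -m'K; congr pickle; apply: (@eq_from_nth _ 0%N); first by rewrite sm sm'.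
  by move=> j; rewrite sm => jk; exact: count_is_inj (Fm j jk) (Fm' j jk).
(* On [F m] the code decides whether a level is below its bound, since the first [j.+1] rings make
   up [[0, b j]]. *)
have levelE w m j : F m w -> (j < k)%N -> (er_map cum (Rs (idx j) w) <= (c j)%:E)%E =
    (idx j < \sum_(l < j.+1) nth 0%N (counts_of_code m) l)%N.
  move=> Fm jk; have [bj _ _ _] := bP j.
  rewrite er_map_cum_le// ?bj; last exact: (RsP.2.1 _ w).1.
  apply: count_is_itv; first by move=> i; exact: RsP.2.1.
  exact: (count_is_seqD bhomo Fm jk).
have mU : measurable (\bigcup_(m in codes_below k idx) F m).
  by apply: bigcup_measurable => m _; exact: mF.
under eq_eseriesr do rewrite -PF.
rewrite -measure_bigcup//.
(* The union of the [F m] lies in [E]; conversely it covers [E] outside the null event that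
   [[0, b k]], which contains all rings used, has no finite count. *)
apply/eqP; rewrite eq_le; apply/andP; split; apply: le_probability_ae => //; last first.
  by apply: aeW => w [m [_ _ mk] Fm] j jk; rewrite (levelE w m) ?mk.
apply: filterS (ae_finite_count (b k)) => w [n wn] Ew.
have /choice[g gP] : forall j, exists i, (j < k)%N -> count_is Rs w (A j) i.
  move=> j; have [jk|_] := boolP (j < k)%N; last by exists 0%N.
  have [i wi] : exists i, count_is Rs w (A j) i.
    apply: (count_is_ex (fun i => RsP.2.1 i w) _ wn) => x /Ab /=.
    by rewrite !in_itv/= => /andP[-> /le_trans]; apply; apply: bhomo; exact: ltnW.
  by exists i.
pose s := mkseq g k; have sK : counts_of_code (pickle s) = s.
  by rewrite /counts_of_code pickleK.
have Fs : F (pickle s) w by move=> j jk; rewrite sK nth_mkseq//; exact: gP.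
exists (pickle s) => //; split; rewrite ?sK ?size_mkseq// => j jk.
by rewrite -sK -(levelE w)// Ew.
Qed.

End PoissonProcess.

(** * Sequences of levels and their sigma-algebra *)

Section Levels.
Set Implicit Arguments.
Unset Strict Implicit.
Context {R : realType}.

Definition levels (lam : R -> R) (T : Type) (Rs : nat -> T -> \bar R) (w : T) :
  nat -> \bar R := fun i => er_map (cum_density lam) (Rs i w).

(** Finite-dimensional lower orthants. An index may recur in the list, so intersection is mere
    concatenation. *)
Definition level_box (s : seq (nat * R)) : set (nat -> \bar R) :=
  [set v | forall p, p \in s -> (v p.1 <= p.2%:E)%E].

Definition level_boxes : set (set (nat -> \bar R)) := range level_box.

(** Sorting by bound provides the monotone bounds that [probability_levels] requires. *)
Definition sort_levels : seq (nat * R) -> seq (nat * R) :=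
  sort (fun p q => p.2 <= q.2).

Lemma level_boxes_setI : setI_closed level_boxes.
Proof.
move=> _ _ [s _ <-] [t _ <-]; exists (s ++ t) => //.
apply/seteqP; split => v /=.
  by move=> st; split=> p ps; apply: st; rewrite mem_cat ps ?orbT.
by move=> [vs vt] p; rewrite mem_cat => /orP[/vs|/vt].
Qed.

Lemma measurable_level i : measurable_fun
  [set: g_sigma_algebraType level_boxes] (fun v : nat -> \bar R => v i).
Proof.
apply: (measurability _ (ErealGenOInfty.measurableE R)).
move=> _ [_ [r ->] <-]; rewrite setTI -[X in measurable X]setCK.
apply: measurableC; apply: sub_sigma_algebra; exists [:: (i, r)] => //.
apply/seteqP; split => v /=.
  move=> /(_ (i, r)); rewrite mem_seq1 eqxx in_itv/= andbT => /(_ isT).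
  by rewrite leNgt => /negP.
rewrite in_itv/= andbT => /negP; rewrite -leNgt => vr p.
by rewrite mem_seq1 => /eqP->.
Qed.

Lemma measurable_CI_points_of_levels (eps : R) (lam : R -> R) :
  0 < eps -> BS_density lam -> measurable_fun
  [set: g_sigma_algebraType level_boxes] (CI eps (points_of_levels lam)).
Proof.
move=> eps0 lamP; apply: (@measurable_CI _ _ eps0 _ (g_sigma_algebraType level_boxes)).
  move=> i; apply: (measurableT_comp (f := fun x : \bar R => ecum_inv lam (maxe 0%E x))).
    apply: nondecreasing_emeasurable => x y xy; apply: ecum_inv_le.
    by rewrite ge_max le_max lexx/= le_max xy orbT.
  exact: measurable_level.
by move=> i v; apply: ecum_inv_ge0 => //; rewrite le_max lexx.
Qed.

Lemma sigma_level_boxes_CI_gt (eps x : R) (lam : R -> R) :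
  0 < eps -> BS_density lam ->
  <<s level_boxes >> [set v | (x%:E < CI eps (points_of_levels lam) v)%E].
Proof.
move=> eps0 lamP; rewrite -[X in <<s _ >> X]setTI.
exact: (emeasurable_fun_o_infty measurableT (measurable_CI_points_of_levels eps0 lamP)).
Qed.

End Levels.

(** * Levels of a Poisson process: measurability and recovery of the points *)

Section LevelsOfPoissonProcess.
Set Implicit Arguments.
Unset Strict Implicit.
Context {R : realType} {d : measure_display} {T : measurableType d}.
Variable P : probability T R.
Variable lam : R -> R.
Variable Rs : nat -> T -> \bar R.
Hypothesis lamP : BS_density lam.
Hypothesis inv_fin : forall q : R, 0 < q -> cum_density_inv lam q \is a fin_num.
Hypothesis RsP : is_ordered_PPP P lam Rs.

Local Notation cum := (cum_density lam).

Lemma measurable_levels : measurable_fun [set: T]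
  (levels lam Rs : T -> g_sigma_algebraType level_boxes).
Proof.
apply: (@measurability _ _ _ (g_sigma_algebraType level_boxes) _ _ level_boxes) => //.
move=> _ [_ [s _ <-] <-]; rewrite setTI.
rewrite (_ : _ @^-1` _ = \bigcap_(p in [set` s])
    (Rs p.1 @^-1` [set x | (er_map cum x <= p.2%:E)%E])) //.
rewrite bigcap_seq; apply: bigsetI_measurable => p _.
rewrite -[X in measurable X]setTI; apply: RsP.1 => //.
by apply: measurable_downset => x y /(er_map_cum_le_mono lamP); exact: le_trans.
Qed.

Lemma measurable_levels_preimage (B : set (nat -> \bar R)) :
  <<s level_boxes >> B -> measurable (levels lam Rs @^-1` B).
Proof.
by move=> sB; rewrite -[X in measurable X]setTI; exact: measurable_levels measurableT _ sB.
Qed.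

Lemma levels_ge0 i w : (0 <= levels lam Rs w i)%E.
Proof.
rewrite /levels; case: (Rs i w) (RsP.2.1 i w).1 => [x| |]//= _.
by rewrite lee_fin cum_density_ge0.
Qed.

Lemma levels_le i w : (levels lam Rs w 0 <= levels lam Rs w i)%E.
Proof.
apply: (er_map_cum_le_mono lamP); apply: points_le => // j; exact: RsP.2.1.
Qed.

Lemma measurable_flat (q : R) : measurable [set r | 0 <= r < q /\ cum r = cum q].
Proof.
apply: is_interval_measurable => x y /= [/andP[x0 xq] cx] [/andP[y0 yq] cy] z /andP[xz zy].
have zq := le_lt_trans zy yq.
split; first by rewrite (le_trans x0 xz).
by apply/eqP; rewrite eq_le -{2}cx !(cum_density_le lamP)// ltW.
Qed.

(** Cutting [[0, q]] at a radius where [cum] is below [cum q], but by at most [e], leaves a ring of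
    intensity at most [e] that contains the flat stretch. *)
Lemma intensity_flat (q : R) :
  intensity lam [set r | 0 <= r < q /\ cum r = cum q] = 0%E.
Proof.
set Z := [set r | _].
have mZ : measurable Z := measurable_flat q.
have Z0 : Z `<=` `[0, +oo[ by move=> x [/andP[x0 _] _]; rewrite /= in_itv/= x0.
have leZ (B : set R) : measurable B -> B `<=` `[0, +oo[ -> Z `<=` B ->
    (intensity lam Z <= intensity lam B)%E.
  move=> mB B0 ZB; apply: ge0_subset_integral => //; first exact: measurable_density.
  by move=> x /B0 /=; rewrite in_itv/= andbT lee_fin; exact: lamP.2.1.
apply/eqP; rewrite eq_le intensity_ge0// andbT.
have [q0|q0] := leP 0 q; last first.
  rewrite (_ : Z = set0) ?/intensity ?integral_set0//.
  by apply/seteqP; split => // x [/andP[x0 /(le_lt_trans x0)]]; rewrite ltNge ltW.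
have [cq0|cq_neq0] := eqVneq (cum q) 0.
  rewrite [leRHS](_ : _ = intensity lam `[0, q]); last by rewrite intensity_cum// cq0.
  apply: leZ => //.
    by move=> x /=; rewrite !in_itv/= andbT => /andP[].
  by move=> x [/andP[x0 xq] _]; rewrite /= in_itv/= x0 ltW.
have cq : 0 < cum q by rewrite lt_neqAle eq_sym cq_neq0 cum_density_ge0.
apply/lee_addgt0Pr => e e0; rewrite add0e.
pose c := Num.max 0 (cum q - e).
have ccq : c < cum q by rewrite gt_max cq gtrBl.
have [|r /andP[r0 rq] rc] := @cum_density_IVT _ _ lamP q c q0.
  by rewrite (ltW ccq) andbT /c le_max lexx.
apply: (@le_trans _ _ (intensity lam (`[0, q] `\` `[0, r]))).
  apply: leZ; first exact: measurableD.
    by move=> x [/=]; rewrite !in_itv/= andbT => /andP[].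
  move=> x [/andP[x0 xq] cx]; split; rewrite /= in_itv/= x0 ?(ltW xq)//=.
  by move=> /(cum_density_le lamP); rewrite cx rc leNgt ccq.
by rewrite intensity_setD// lee_fin rc lerBlDr -lerBlDl le_max lexx orbT.
Qed.

(** Two null events are discarded: a point where [cum] is still 0, which would have level 0, and a
    point inside a flat stretch, which [ecum_inv] would move to the right. *)
Lemma ae_levels : {ae P, forall w, (0 < levels lam Rs w 0)%E /\
  forall i, points_of_levels lam i (levels lam Rs w) = Rs i w}.
Proof.
have [m0 [Em0 m0_ge0 cm0 m0E]] := ecum_inv_fin lamP inv_fin (lexx 0).
have pos : {ae P, forall w, forall i x, Rs i w = x%:E -> ~ `[0, m0]%classic x}.
  by apply: (@ae_no_points _ _ _ _ _ _ RsP _ m0) => //; rewrite intensity_cum// cm0.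
(* [unpickle] enumerates the rational endpoints, so only countably many null events are united; the
   default 0 gives an empty stretch. *)
have flat : {ae P, forall w, forall n i x, Rs i w = x%:E ->
    ~ (let q := ratr (odflt (0 : rat) (unpickle n)) in 0 <= x < q /\ cum x = cum q)}.
  pose Z n : set R := [set r |
    let q := ratr (odflt (0 : rat) (unpickle n)) in 0 <= r < q /\ cum r = cum q].
  have Zn n : P.-negligible (~` [set w | forall i x, Rs i w = x%:E -> ~ Z n x]).
    apply: (@ae_no_points _ _ _ _ _ _ RsP (Z n) (ratr (odflt (0 : rat) (unpickle n)))).
    - exact: measurable_flat.
    - by move=> x [/andP[x0 xq] _]; rewrite /= in_itv/= x0 ltW.
    - exact: intensity_flat.
  apply: negligibleS (negligible_bigcup Zn) => w /=.
  move=> /existsNP[n wn]; exists n => //.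
apply: filterS2 pos flat => w pos flat.
have w_ge0 i : (0 <= Rs i w)%E := (RsP.2.1 i w).1.
have invE i : ecum_inv lam (levels lam Rs w i) = Rs i w.
  rewrite /levels; case Ri : (Rs i w) (w_ge0 i) => [x| |]//= x0; last exact: ecum_invy.
  rewrite lee_fin in x0; have [//|ne] := eqVneq (ecum_inv lam (cum x)%:E) x%:E.
  have [q xq cq] := cum_density_flat lamP inv_fin x0 ne.
  by have [] := flat (pickle q) i x Ri; rewrite pickleK/= x0 xq.
split; last by move=> i; rewrite /points_of_levels max_r ?levels_ge0.
rewrite lt_neqAle levels_ge0 andbT /levels; apply/eqP.
case R0 : (Rs 0%N w) (w_ge0 0%N) => [x| |]//= x0 [cx].
rewrite lee_fin in x0.
by apply: (pos _ _ R0); rewrite /= in_itv/= x0 -m0E// -cx lexx.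
Qed.

Lemma ae_CI_levels (eps x : R) : 0 < eps ->
  P [set w | (x%:E < CI eps Rs w)%E] =
  P [set w | (x%:E < CI eps (points_of_levels lam) (levels lam Rs w))%E].
Proof.
move=> eps0.
have m1 : measurable [set w | (x%:E < CI eps Rs w)%E].
  rewrite -[X in measurable X]setTI; apply: emeasurable_fun_o_infty => //.
  by apply: measurable_CI => //; [exact: RsP.1|move=> i w; exact: (RsP.2.1 i w).1].
have m2 : measurable
    [set w | (x%:E < CI eps (points_of_levels lam) (levels lam Rs w))%E].
  exact: measurable_levels_preimage (sigma_level_boxes_CI_gt _ eps0 lamP).
have E : {ae P, forall w,
    CI eps Rs w = CI eps (points_of_levels lam) (levels lam Rs w)}.
  apply: filterS ae_levels => w [_ pE]; rewrite /CI pE; congr (_ * _^-1)%E.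
  by apply: eq_eseriesr => i _; rewrite pE.
by apply/eqP; rewrite eq_le; apply/andP; split; apply: le_probability_ae => //;
  apply: filterS E => w /= ->.
Qed.

Lemma probability_level_box_neg (s : seq (nat * R)) (p : nat * R) :
  p \in s -> p.2 < 0 -> P (levels lam Rs @^-1` level_box s) = 0%E.
Proof.
move=> ps p0; rewrite (_ : _ @^-1` _ = set0) ?measure0//.
apply/seteqP; split => // w /(_ p ps); rewrite leNgt => /negP; apply.
by apply: lt_le_trans (levels_ge0 p.1 w); rewrite lte_fin.
Qed.

(** A box does not depend on the order of its constraints; sorted, it has the form treated by
    [probability_levels]. *)
Lemma probability_level_box (s : seq (nat * R)) (c : nat -> R) :
  (forall j, (j < size (sort_levels s))%N ->
     c j = (nth (0%N, 0) (sort_levels s) j).2) ->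
  P (levels lam Rs @^-1` level_box s) =
  P [set w | forall j, (j < size (sort_levels s))%N ->
    (er_map cum (Rs (nth (0%N, 0%R) (sort_levels s) j).1 w) <= (c j)%:E)%E].
Proof.
set t := sort_levels s => ct; congr (P _).
have ts p : (p \in t) = (p \in s) by rewrite mem_sort.
apply/seteqP; split => w /=; first by move=> sw j jt; rewrite ct//; apply: sw; rewrite -ts mem_nth.
move=> tw p; rewrite -ts => pt; have := tw (index p t); rewrite index_mem => /(_ pt).
by rewrite ct ?index_mem// nth_index.
Qed.

End LevelsOfPoissonProcess.

(** * Equality of the laws of the levels, and stochastic comparison *)

Lemma sorted_snd_monotone {R : realType} (t : seq (nat * R)) :
  sorted (fun p q => p.2 <= q.2) t -> all (fun p => 0 <= p.2) t ->
  exists c : nat -> R, [/\ {homo c : i j / (i <= j)%N >-> i <= j}, 0 <= c 0%N &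
    forall j, (j < size t)%N -> c j = (nth (0%N, 0%R) t j).2].
Proof.
move=> ts t0; have [/size0nil ->|t_gt0] := posnP (size t).
  by exists (fun=> 0); split.
have kt : ((size t).-1 < size t)%N by rewrite prednK.
have minnt j : (minn j (size t).-1 < size t)%N := leq_ltn_trans (geq_minr _ _) kt.
(* Beyond the list the bounds are frozen at the last entry, which keeps the sequence monotone on all
   of [nat]. *)
exists (fun j => (nth (0%N, 0%R) t (minn j (size t).-1)).2); split.
- move=> i j ij.
  have tr : transitive (fun p q : nat * R => p.2 <= q.2).
    by move=> q p r; exact: le_trans.
  apply: (sorted_leq_nth tr) => //; rewrite ?inE//.
  by rewrite leq_min geq_minr andbT (leq_trans (geq_minl _ _) ij).
- by have /(allP t0) := mem_nth (0%N, 0%R) (minnt 0%N).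
- by move=> j jt; rewrite (minn_idPl _)// -ltnS prednK.
Qed.

(** Boxes form a pi-system generating the sigma-algebra, so the two push-forwards agree once they
    agree on boxes, whose probability does not involve the density. *)
Lemma levels_law {R : realType} (lam1 lam2 : R -> R) :
  BS_density lam1 -> BS_density lam2 ->
  (forall q : R, 0 < q -> cum_density_inv lam1 q \is a fin_num) ->
  (forall q : R, 0 < q -> cum_density_inv lam2 q \is a fin_num) ->
  forall (d1 d2 : measure_display) (T1 : measurableType d1) (T2 : measurableType d2)
    (P1 : probability T1 R) (P2 : probability T2 R)
    (Rs1 : nat -> T1 -> \bar R) (Rs2 : nat -> T2 -> \bar R),
  is_ordered_PPP P1 lam1 Rs1 -> is_ordered_PPP P2 lam2 Rs2 ->
  forall B : set (nat -> \bar R), <<s level_boxes >> B ->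
  P1 (levels lam1 Rs1 @^-1` B) = P2 (levels lam2 Rs2 @^-1` B).
Proof.
move=> L1 L2 F1 F2 d1 d2 T1 T2 P1 P2 Rs1 Rs2 H1 H2.
pose X1 : {mfun T1 >-> g_sigma_algebraType (@level_boxes R)} :=
  HB.pack (levels lam1 Rs1) (isMeasurableFun.Build _ _ _ _ _ (measurable_levels L1 H1)).
pose X2 : {mfun T2 >-> g_sigma_algebraType (@level_boxes R)} :=
  HB.pack (levels lam2 Rs2) (isMeasurableFun.Build _ _ _ _ _ (measurable_levels L2 H2)).
apply: (@g_sigma_algebra_measure_unique _ _ (g_sigma_algebraType (@level_boxes R))
  level_boxes _ (fun=> setT) _ _ (pushforward P1 X1) (pushforward P2 X2)).
- by move=> A GA; exact: sub_sigma_algebra.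
- by move=> _; exists [::] => //; apply/seteqP; split.
- by rewrite bigcup_const//; exists 0%N.
- exact: level_boxes_setI.
- move=> _ [s _ <-].
  change (P1 (levels lam1 Rs1 @^-1` level_box s) = P2 (levels lam2 Rs2 @^-1` level_box s)).
  (* [probability_levels] needs nonnegative bounds; a box with a negative bound is null for both
     systems. *)
  have [/hasP[p ps p0]|nneg] := boolP (has (fun p : nat * R => p.2 < 0) s).
    by rewrite (probability_level_box_neg L1 H1 ps p0) (probability_level_box_neg L2 H2 ps p0).
  have [||c [chomo c0 ct]] := @sorted_snd_monotone R (sort_levels s).
  - by apply: sort_sorted => p q; exact: le_total.
  - by rewrite all_sort; apply/allP => p /(hasPn nneg); rewrite -leNgt.
  by rewrite !(probability_level_box _ _ _ ct) (probability_levels L1 F1 H1)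
    ?(probability_levels L2 F2 H2).
- by move=> k; change (P1 setT < +oo)%E; rewrite probability_setT ltry.
Qed.

Theorem theorem1 (R : realType) (eps : R) (lam1 lam2 : R -> R) :
  0 < eps ->
  BS_density lam1 -> BS_density lam2 ->
  (forall q : R, 0 < q ->
     exists m1 m2 : R,
       [/\ cum_density_inv lam1 q = m1%:E, cum_density_inv lam2 q = m2%:E &
         let a := m2 / m1 in
         forall r : R, m2 <= r -> lam2 r <= a^-1 * lam1 (r / a)]) ->
  forall (d1 d2 : measure_display) (T1 : measurableType d1) (T2 : measurableType d2)
         (P1 : probability T1 R) (P2 : probability T2 R)
         (Rs1 : nat -> T1 -> \bar R) (Rs2 : nat -> T2 -> \bar R),
    is_ordered_PPP P1 lam1 Rs1 -> is_ordered_PPP P2 lam2 Rs2 ->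
    forall x : R,
      (P1 [set w | (x%:E < CI eps Rs1 w)%E] <= P2 [set w | (x%:E < CI eps Rs2 w)%E])%E.
Proof.
move=> eps0 L1 L2 lam12 d1 d2 T1 T2 P1 P2 Rs1 Rs2 H1 H2 x.
have F1 p : 0 < p -> cum_density_inv lam1 p \is a fin_num.
  by move=> /lam12[m1 [m2 [-> _ _]]].
have F2 p : 0 < p -> cum_density_inv lam2 p \is a fin_num.
  by move=> /lam12[m1 [m2 [_ -> _]]].
pose B lam := [set v | (x%:E < CI eps (points_of_levels lam) v)%E].
have sB lam : BS_density lam -> <<s level_boxes >> (B lam).
  by move=> lamP; exact: sigma_level_boxes_CI_gt.
rewrite (ae_CI_levels L1 F1 H1)// (ae_CI_levels L2 F2 H2)//.
(* The second event is moved to the levels of the first process, so both events live on [T1] and are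
   driven by the same levels; no joint space has to be built. *)
rewrite -[leRHS](levels_law L1 L2 F1 F2 H1 H2 (sB lam2 L2)).
have mB lam (lamP : BS_density lam) := measurable_levels_preimage L1 H1 (sB lam lamP).
apply: (le_probability_ae (mB lam1 L1) (mB lam2 L2)).
apply: filterS (ae_levels L1 F1 H1) => w [w0 _] /=.
have le12 := CI_points_of_levels_le eps0 L1 L2 lam12 w0 (fun i => levels_le L1 H1 i w).
by move=> xw; exact: lt_le_trans xw le12.
Qed.
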